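(* Let $S$ be a semigroup, $\lambda$ a non-zero cardinal and $n$ a positive integer with $n\leqslant\lambda$. For every positive integer $i\leqslant n$, a non-zero element $$\alpha_S=\begin{pmatrix} a_1&\cdots&a_i\\ s_1&\cdots&s_i\\ b_1&\cdots&b_i\end{pmatrix}$$ of the semigroup $\mathscr{I}_\lambda^n(S)$ is an idempotent if and only if $a_1=b_1,\ldots,a_i=b_i$ and $s_1,\ldots,s_i\in E(S)$.
   Context: $E(S)$ denotes the set of idempotents of $S$. $\mathscr{I}_\lambda^n$ is the semigroup of all partial injective maps $\lambda\rightharpoonup\lambda$ of rank (cardinality of the range) at most $n$, with composition $x(\alpha\beta)=(x\alpha)\beta$; its zero is the empty map. The semigroup $\mathscr{I}_\lambda^n(S)$ consists of all maps $\alpha_S\colon \mathrm{Gr}(\alpha)\to S$, where $\alpha\in\mathscr{I}_\lambda^n$ and $\mathrm{Gr}(\alpha)\subset\lambda\times\lambda$ is the graph of $\alpha$; the element with empty graph is denoted $0$. A non-zero element is written $\begin{pmatrix} x_1&\cdots&x_k\\ s_1&\cdots&s_k\\ y_1&\cdots&y_k\end{pmatrix}$ ($1\leqslant k\leqslant n$, the $x_l\in\lambda$ pairwise distinct, the $y_l\in\lambda$ pairwise distinct, $s_l\in S$), meaning $\alpha$ maps $x_l$ to $y_l$ and $\alpha_S$ sends $(x_l,y_l)$ to $s_l$; the order of the columns is immaterial. The product $\alpha_S\cdot\beta_S$ has as underlying partial map the composition $\alpha\beta$, and if $(a,b)\in\mathrm{Gr}(\alpha)$ is sent to $s$ by $\alpha_S$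 and $(b,d)\in\mathrm{Gr}(\beta)$ is sent to $t$ by $\beta_S$, then $\alpha_S\cdot\beta_S$ sends $(a,d)$ to $st$; in particular the product is $0$ if $\alpha\beta$ is empty. *)

(* Defs.v *)
From HB Require Import structures.
From mathcomp Require Import all_boot.
From mathcomp Require Import boolp classical_sets functions cardinality.

Set Implicit Arguments.
Unset Strict Implicit.
Unset Printing Implicit Defensive.

Local Open Scope classical_set_scope.
Local Open Scope card_scope.
Local Open Scope group_scope.

Definition idempotents (S : magmaType) : set S := [set e | e * e = e].
Arguments idempotents S : clear implicits.

Notation "''E' ( S )" := (idempotents S) (at level 8, format "''E' ( S )").

Definition graph (L : Type) (f : L -> option L) : set (L * L) :=
  [set p | f p.1 = Some p.2].

Definition edge (L : Type) (f : L -> option L) (p : L * L)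
    (fp : p \in graph f) : graph f := exist (fun q => q \in graph f) p fp.

(* The cardinal lambda is represented by a type L; [None] means undefined. *)
Record pinj (L : Type) (n : nat) := Pinj {
  pfun :> L -> option L;
  pfun_inj : forall x1 x2 y,
    pfun x1 = Some y -> pfun x2 = Some y -> x1 = x2;
  pfun_rank : [set y | exists x, pfun x = Some y] #<= `I_n }.

Lemma pinj_ext (L : Type) n (f g : pinj L n) : pfun f = pfun g -> f = g.
Proof.
case: f g => [f fi fr] [g gi gr] /= fg; case: g / fg gi gr => gi gr.
by rewrite (Prop_irrelevance fi gi) (Prop_irrelevance fr gr).
Qed.

Section Composition.
Variables (L : Type) (n : nat).

(* x (f g) = (x f) g : f is applied first *)
Definition pcomp_fun (f g : L -> option L) (x : L) : option L := obind g (f x).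

Lemma pcomp_inj (f g : pinj L n) x1 x2 y :
  pcomp_fun f g x1 = Some y -> pcomp_fun f g x2 = Some y -> x1 = x2.
Proof.
rewrite /pcomp_fun; case E1: (f x1) => [z1|//] /= h1.
case E2: (f x2) => [z2|//] /= h2.
by rewrite (pfun_inj h1 h2) in E1; exact: pfun_inj E1 E2.
Qed.

Lemma pcomp_rank (f g : pinj L n) :
  [set y | exists x, pcomp_fun f g x = Some y] #<= `I_n.
Proof.
apply: card_le_trans (pfun_rank g); apply: subset_card_le => y /= [x].
by rewrite /pcomp_fun; case: (f x) => [z|//] /= h; exists z.
Qed.

Definition pcomp (f g : pinj L n) : pinj L n :=
  Pinj (@pcomp_inj f g) (pcomp_rank f g).

Lemma graph_pcomp (f g : pinj L n) (p : L * L) : p \in graph (pcomp f g) ->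
  exists2 b, (p.1, b) \in graph f & (b, p.2) \in graph g.
Proof.
rewrite inE /graph /= /pcomp_fun; case E: (f p.1) => [b|//] /= h.
by exists b; rewrite inE.
Qed.

Lemma pempty_rank : [set y : L | exists x : L, None = Some y] #<= `I_n.
Proof.
suff -> : [set y : L | exists x : L, None = Some y] = set0 by exact: card_ge0.
by apply/seteqP; split => y // [].
Qed.

Definition pempty : pinj L n :=
  @Pinj L n (fun=> None) (fun _ _ _ h => ltac:(discriminate h)) pempty_rank.

End Composition.

(* I_lambda^n(S) *)
Record isym (L : Type) (n : nat) (S : Type) := ISym {
  isym_pinj : pinj L n;
  isym_map :> graph isym_pinj -> S }.

Section ISymSemigroup.
Variables (L : Type) (n : nat).

HB.instance Definition _ (S : Type) := gen_eqMixin (isym L n S).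
HB.instance Definition _ (S : Type) := gen_choiceMixin (isym L n S).

Definition isym0 (S : Type) : isym L n S :=
  @ISym L n S (pempty L n)
    (fun p => ltac:(have := set_valP p; discriminate)).

(* The chosen b is the only possible one, since the graph of x is functional: see isym_mulE. *)
Definition isym_mul_map (S : magmaType) (x y : isym L n S)
    (p : graph (pcomp (isym_pinj x) (isym_pinj y))) : S :=
  let: exist2 b ab bd := cid2 (graph_pcomp (valP p)) in
  x (edge ab) * y (edge bd).

Definition isym_mul (S : magmaType) (x y : isym L n S) : isym L n S :=
  ISym (@isym_mul_map S x y).

Lemma isym_mulE (S : magmaType) (x y : isym L n S) a b d
    (ab : (a, b) \in graph (isym_pinj x)) (bd : (b, d) \in graph (isym_pinj y))
    (ad : (a, d) \in graph (isym_pinj (isym_mul x y))) :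
  isym_mul x y (edge ad) = x (edge ab) * y (edge bd).
Proof.
rewrite /= /isym_mul_map /=; case: cid2 => /= b' ab' bd'.
have eb : b' = b.
  by move: ab ab'; rewrite !inE /graph /= => -> [].
rewrite {}eb in ab' bd' *.
by rewrite (bool_irrelevance ab' ab) (bool_irrelevance bd' bd).
Qed.

Lemma isym_ext (S : Type) (x y : isym L n S) :
  (forall a, isym_pinj x a = isym_pinj y a) ->
  (forall p (px : p \in graph (isym_pinj x)) (py : p \in graph (isym_pinj y)),
    x (edge px) = y (edge py)) ->
  x = y.
Proof.
case: x y => [f u] [g v] /= fg uv.
have {}fg : f = g by apply/pinj_ext/funext.
case: g / fg v uv => v uv; congr ISym; apply/funext => -[p hp]; exact: uv.
Qed.

Lemma isym_mulA (S : semigroupType) : associative (@isym_mul S).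
Proof.
move=> x y z; apply: isym_ext => [a|[a d] p1 p2].
  by rewrite /= /pcomp_fun /=; case: (isym_pinj x a).
have [/= b ab bd0] := graph_pcomp p1.
have bd : (b, d) \in graph (isym_pinj (isym_mul y z)) := bd0.
have [/= c bc cd] := graph_pcomp bd0.
have ac : (a, c) \in graph (isym_pinj (isym_mul x y)).
  move: ab bc; rewrite !inE /graph /= /pcomp_fun => -> /=; exact.
apply: (etrans (isym_mulE ab bd p1)); rewrite (isym_mulE bc cd bd) mulgA.
by rewrite -(isym_mulE ab bc ac); apply/esym; exact: isym_mulE.
Qed.

HB.instance Definition _ (S : semigroupType) :=
  isSemigroup.Build (isym L n S) (@isym_mulA S).

End ISymSemigroup.

(* x is the element written as the matrix with columns (a l, s l, b l). *)
Definition has_columns (L : Type) (n : nat) (S : Type) (x : isym L n S)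
    (i : nat) (a : 'I_i -> L) (s : 'I_i -> S) (b : 'I_i -> L) : Prop :=
  [/\ injective a, injective b,
      graph (isym_pinj x) = range (fun l => (a l, b l))
    & forall l (p : (a l, b l) \in graph (isym_pinj x)),
        x (edge p) = s l].

(* Main.v *)
Require Import Defs.
From mathcomp Require Import all_boot.
From mathcomp Require Import boolp classical_sets functions cardinality.

Local Open Scope classical_set_scope.
Local Open Scope card_scope.

(** If [x] is idempotent and its partial map sends [a] to [d], then
    [x x = x] says that it also sends [d] to [d], so injectivity gives [a = d];
    hence the underlying map is a partial identity.  Over a fixed point [a] the
    only factorization of the edge [(a, a)] goes through [a] itself, so the label
    of [x x] there is the square of the label of [x], and idempotency of [x]
    amounts to idempotency of every label.  The lemma [isym_idempotentP] states
    this without reference to a list of columns; the theorem transports it along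
    the enumeration of the graph by columns. *)

(** Equality of elements does not let one rewrite under [edge], since the
    membership proof depends on the underlying map; this is the usable form. *)
Lemma isym_eq_edge {L : Type} {n : nat} {S : Type} {x y : isym L n S}
    {p : L * L} (px : p \in graph (isym_pinj x))
    (py : p \in graph (isym_pinj y)) :
  x = y -> x (edge px) = y (edge py).
Proof. by move=> xy; case: y / xy py => py; rewrite (bool_irrelevance px py). Qed.

Lemma isym_idempotentP (L : Type) (n : nat) (S : semigroupType)
    (x : isym L n S) :
  'E(isym L n S) x <->
  forall p (xp : p \in graph (isym_pinj x)),
    p.1 = p.2 /\ 'E(S) (x (edge xp)).
Proof.
split=> [xx [a d] xp /=|loops].
  have xad : isym_pinj x a = Some d by move: (xp); rewrite inE.
  have xd : isym_pinj x d = Some d.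
    have /(congr1 (fun y => isym_pinj y a)) := xx.
    by rewrite /= /pcomp_fun xad.
  have ad : a = d := pfun_inj xad xd.
  case: d / ad xp xad xd => xp _ xa; split=> //.
  have xxp : (a, a) \in graph (isym_pinj (isym_mul x x)).
    by rewrite inE /graph /= /pcomp_fun xa.
  exact: etrans (esym (isym_mulE xp xp xxp)) (isym_eq_edge xxp xp xx).
have xfix a d : isym_pinj x a = Some d -> a = d.
  move=> xad; have xp : (a, d) \in graph (isym_pinj x) by rewrite inE.
  by have [] := loops _ xp.
apply: isym_ext => [a|[a d] xxp xp].
  rewrite /= /pcomp_fun; case xad: (isym_pinj x a) => [d|//] /=.
  by move: (xad); rewrite (xfix _ _ xad).
have [/= ad idem] := loops _ xp.
case: d / ad xxp xp idem => xxp xp idem.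
exact: etrans (isym_mulE xp xp xxp) idem.
Qed.

Theorem proposition3p1 (S : semigroupType) (L : Type) (n : nat)
    (hL : [set: L] !=set0) (hn : (0 < n)%N) (hnL : `I_n #<= [set: L])
    (i : nat) (hi : (0 < i)%N) (hin : (i <= n)%N)
    (alpha : isym L n S) (halpha : alpha <> isym0 L n S)
    (a : 'I_i -> L) (s : 'I_i -> S) (b : 'I_i -> L)
    (hcol : has_columns alpha a s b) :
  'E(isym L n S) alpha <->
  (forall l, a l = b l) /\ (forall l, 'E(S) (s l)).
Proof.
have [_ _ graphE labelE] := hcol.
have col l : (a l, b l) \in graph (isym_pinj alpha).
  by rewrite graphE inE; exists l.
rewrite isym_idempotentP; split=> [loops|[ab ss] p xp].
  by split=> l; have [] := loops _ (col l); rewrite ?labelE.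
have : range (fun l => (a l, b l)) p by rewrite -graphE -inE.
case=> l _ pE; case: p / pE xp => xp.
by rewrite labelE; split; [exact: ab | exact: ss].
Qed.
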